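(* There is an absolute constant $c>0$ such that the following holds. Let $k\ge1$, $n=2^k$, let $\mathbb{F}$ be any field, and let $d\le n$ be sufficiently large (larger than some absolute constant). Then any set-multilinear formula over $\mathbb{F}$, set-multilinear with respect to $(X_1,\dots,X_d)$ (of arbitrary depth), computing $NW_{n,d}$ has size at least $d^{c\log d}$.
   Context: Let $\mathbb{F}_n$ be the finite field with $n$ elements, and fix a bijection $\phi:[n]\to\mathbb{F}_n$; through it we identify $[n]$ with $\mathbb{F}_n$. For $f\in\mathbb{F}_n[z]$ and $j\in[d]$, $f(j)$ means $\phi^{-1}(f(\phi(j)))\in[n]$. Variables are $x_{i,j}$, $i\in[n]$, $j\in[d]$, partitioned as $X_j=\{x_{i,j}:i\in[n]\}$, $j\in[d]$. The Nisan–Wigderson polynomial (coefficients in $\mathbb{F}$) is $NW_{n,d}=\sum_{f\in\mathbb{F}_n[z],\ \deg f<d/2}\prod_{j\in[d]}x_{f(j),j}$. An algebraic formula is a rooted tree whose internal nodes are labeled $+$ or $\times$ and whose leaves are labeled by variables or field constants; its size is its number of nodes. A polynomial is set-multilinear with respect to $(X_j)_{j\in S}$ if every monomial contains exactly one variable from each $X_j$, $j\in S$, and no other variables; a formula is set-multilinear with respect to $(X_1,\dots,X_d)$ if every node computes a polynomial set-multilinear with respect to $(X_j)_{j\in S}$ for some $S\subseteq[d]$. Logarithms are base 2. *)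

(* Defs.v *)
From HB Require Import structures.
From mathcomp Require Import all_boot all_order all_algebra.
From mathcomp Require Import mpoly.

Set Implicit Arguments.
Unset Strict Implicit.
Unset Printing Implicit Defensive.

Import GRing.Theory.
Local Open Scope ring_scope.

Section SetMultilinear.
Variables (n d : nat) (F : fieldType).

(* [mxvec_index] is the bijection 'I_n * 'I_d -> 'I_(n * d), so the n * d
   indeterminates are indexed by the pairs (i, j). *)
Definition xvar (i : 'I_n) (j : 'I_d) : {mpoly F[n * d]} :=
  'X_(mxvec_index i j).

(* The exponents are counted with multiplicity, so x_{i,j}^2 is excluded.
   The zero polynomial is set-multilinear with respect to every S. *)
Definition set_multilinear (S : {set 'I_d}) (p : {mpoly F[n * d]}) : bool :=
  all (fun m : 'X_{1..n * d} =>
         [forall j : 'I_d,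
            (\sum_(i < n) m (mxvec_index i j))%N == (j \in S) :> nat])
      (msupp p).

(* Fan-in is unbounded. A childless sum (product) node is just another way of
   writing the leaf 0 (the leaf 1), with the same size. *)
Inductive formula : Type :=
| FVar of 'I_n & 'I_d
| FConst of F
| FAdd of seq formula
| FMul of seq formula.

Fixpoint feval (G : formula) : {mpoly F[n * d]} :=
  match G with
  | FVar i j => xvar i j
  | FConst a => a%:MP
  | FAdd s => \sum_(p <- map feval s) p
  | FMul s => \prod_(p <- map feval s) p
  end.

(* One entry per node of the tree: the subformula rooted at that node. *)
Fixpoint fnodes (G : formula) : seq formula :=
  G :: match G with
       | FVar _ _ | FConst _ => [::]
       | FAdd s | FMul s => flatten (map fnodes s)
       end.

Definition fsize (G : formula) : nat := size (fnodes G).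

Definition set_multilinear_formula (G : formula) : bool :=
  all (fun N => [exists S : {set 'I_d}, set_multilinear S (feval N)])
      (fnodes G).

End SetMultilinear.

(* [phi] identifies 'I_n with the field K and [psi] is its inverse; [d] is seen
   as a subset of [n] through [hdn]. {poly_m K} is the finite type of the
   polynomials with at most m coefficients, i.e. of degree < m (0 included);
   for an integer degree, deg f < d/2 iff deg f < uphalf d = ceil(d/2). *)
Definition NW (n d : nat) (hdn : (d <= n)%N) (K : finFieldType)
    (phi : 'I_n -> K) (psi : K -> 'I_n) (F : fieldType) : {mpoly F[n * d]} :=
  \sum_(f : {poly_(uphalf d) K})
    \prod_(j < d) xvar F (psi (val f).[phi (widen_ord hdn j)]) j.

(* Main.v *)
(** Split the index set of the blocks X_j into two halves by a random set [w] and let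
rho_w(p) be the rank of the coefficient matrix of [p] (rows: monomials in the blocks of
[w], columns: monomials in the other blocks), divided by n^(|S|/2). A Nisan-Wigderson
polynomial has rho_w = 1 whenever [w] is balanced, because a polynomial of degree < d/2 is
determined by its values on either half. Conversely rho_w is subadditive, multiplicative
over products in disjoint blocks, and at most 2^-|imbalance of w on S|, whose mean over [w]
is O(|S|^(-1/2)). Since disjoint blocks are split independently, an induction on the formula
bounds the mean of rho_w by size * exp(- decay |S|) with decay m of order log^2 m: at a
product of two factors, the larger one is bounded by induction and the smaller one by the
imbalance estimate, and decay grows slowly enough for the latter to pay for the increase of
|S|. *)
Require Import Defs.
From mathcomp Require Import all_boot all_order all_algebra.
From mathcomp Require Import mpoly.
From mathcomp Require Import zify ring lra.
From mathcomp Require Import reals sequences exp.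

Set Implicit Arguments.
Unset Strict Implicit.
Unset Printing Implicit Defensive.

Import Order.TTheory GRing.Theory Num.Theory.
Local Open Scope ring_scope.

(** * The mean imbalance of a random bipartition *)

Lemma bin_odd_mid h : 'C(h.*2.+1, h.+1) = 'C(h.*2.+1, h).
Proof.
have le_h : (h <= h.*2.+1)%N by lia.
by have := bin_sub le_h; have -> : (h.*2.+1 - h = h.+1)%N by lia.
Qed.

Lemma central_binS h :
  (h.+1 * 'C(h.+1.*2, h.+1) = 2 * h.*2.+1 * 'C(h.*2, h))%N.
Proof.
rewrite doubleS binS -bin_odd_mid.
have := mul_bin_diag h.*2.+1 h => /=.
by move: 'C(_, h.+1) 'C(_, h) => a b; lia.
Qed.

(** By [central_binS] the induction step amounts to 4 (2h + 1) (2h + 3) <= 16 (h + 1)^2. Squaring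
    expresses a decay of order h^(-1/2) without roots. *)
Lemma central_bin_sqr h : ('C(h.*2, h) ^ 2 * h.*2.+1 <= 16 ^ h)%N.
Proof.
elim: h => // h IH.
suff: (h.+1 ^ 2 * ('C(h.+1.*2, h.+1) ^ 2 * h.+1.*2.+1) <= h.+1 ^ 2 * 16 ^ h.+1)%N.
  by rewrite leq_pmul2l.
have -> : (h.+1 ^ 2 * ('C(h.+1.*2, h.+1) ^ 2 * h.+1.*2.+1) =
  4 * h.*2.+1 * h.+1.*2.+1 * ('C(h.*2, h) ^ 2 * h.*2.+1))%N.
  by rewrite mulnA -expnMn central_binS; ring.
rewrite (expnS 16) [leqRHS]mulnA; apply: leq_mul => //; rewrite -mulnn; nia.
Qed.

Lemma central_bin_ge h : (4 ^ h <= h.*2.+1 * 'C(h.*2, h))%N.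
Proof.
elim: h => // h IH.
suff: (h.+1 * 4 ^ h.+1 <= h.+1 * (h.+1.*2.+1 * 'C(h.+1.*2, h.+1)))%N.
  by rewrite leq_pmul2l.
have -> : (h.+1 * (h.+1.*2.+1 * 'C(h.+1.*2, h.+1)) =
  2 * h.+1.*2.+1 * (h.*2.+1 * 'C(h.*2, h)))%N.
  by rewrite mulnCA central_binS; ring.
rewrite (expnS 4) [leqLHS]mulnA; apply: leq_mul => //; lia.
Qed.

Lemma mid_bin_sqr m : ('C(m, m./2) ^ 2 * m.+1 <= 4 ^ m)%N.
Proof.
rewrite -(odd_double_half m); case: (odd m) => /=; set h := m./2; last first.
  rewrite add0n doubleK; apply: leq_trans (central_bin_sqr h) _.
  by rewrite -muln2 mulnC expnM.
rewrite add1n /= uphalf_double.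
have E : ('C(h.+1.*2, h.+1) = 2 * 'C(h.*2.+1, h))%N.
  by rewrite doubleS binS bin_odd_mid addnn -mul2n.
have := central_bin_sqr h.+1; rewrite E -(@leq_pmul2l 4 (_ * _) (4 ^ _)) //.
rewrite (_ : (4 * 4 ^ h.*2.+1 = 16 ^ h.+1)%N); last first.
  by rewrite -expnS -doubleS -muln2 mulnC expnM.
by apply: leq_trans; rewrite mulnA expnMn; apply: leq_mul; lia.
Qed.

Lemma bin_le_mid m k : ('C(m, k) <= 'C(m, m./2))%N.
Proof.
have step i : (i < m./2 -> 'C(m, i) <= 'C(m, i.+1))%N.
  move=> lt_i; rewrite -(@leq_pmul2l i.+1) // mul_bin_left.
  by rewrite leq_mul2r; apply/orP; right; lia.
have low i : (i <= m./2 -> 'C(m, i) <= 'C(m, m./2))%N.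
  move=> le_i; rewrite -(subKn le_i); elim: (m./2 - i)%N => [|j IH].
    by rewrite subn0.
  case: (ltnP j m./2) => lt_j; last first.
    by rewrite (_ : m./2 - j.+1 = m./2 - j)%N //; lia.
  apply: leq_trans IH; rewrite (_ : m./2 - j = (m./2 - j.+1).+1)%N; last by lia.
  by apply: step; lia.
case: (leqP k m./2) => [/low //|lt_k].
case: (leqP k m) => [le_km|/bin_small -> //].
rewrite -(@bin_sub m k) //.
by apply: low; lia.
Qed.

(** With truncated subtraction one of the two terms is 0, so this is |p - q|. *)
Definition gap p q : nat := (p - q + (q - p))%N.

Section Bias.
Variable R : realFieldType.

Definition gap_sum m : R := \sum_(k < m.+1) 2^-1 ^+ gap k (m - k).

Lemma gap_sum0 : gap_sum 0 = 1.
Proof. by rewrite /gap_sum big_ord1. Qed.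

Lemma gap_sum1 : gap_sum 1 = 1.
Proof. by rewrite /gap_sum 2!big_ord_recl big_ord0 /= !expr1; lra. Qed.

Lemma gap_sumSS m : gap_sum m.+2 = gap_sum m + 2^-1 ^+ m.+1.
Proof.
rewrite /gap_sum big_ord_recr big_ord_recl /=.
rewrite (eq_bigr (fun i : 'I_m.+1 => 2^-1 ^+ gap i (m - i))); last first.
  move=> i _; congr (_ ^+ _); rewrite /gap /bump /=.
  by have := ltn_ord i; lia.
have -> : gap 0 (m.+2 - 0) = m.+2 by rewrite /gap; lia.
have -> : gap m.+2 (m.+2 - m.+2) = m.+2 by rewrite /gap; lia.
rewrite exprS; set a := _ ^+ m.+1; lra.
Qed.

(** The subtracted term carries the induction: from m to m + 2 the sum gains half of 2^-m and the
    bound gains three quarters of it. *)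
Lemma gap_sum_le m : gap_sum m <= 2 - 2^-1 ^+ m.
Proof.
have [k] := ubnP m; elim: k m => // k IH [|[|m]] lt_mk.
- by rewrite gap_sum0 expr0; lra.
- by rewrite gap_sum1 expr1; lra.
have {IH} := IH m ltac:(lia); rewrite gap_sumSS !exprS.
have : 0 <= 2^-1 ^+ m :> R by apply: exprn_ge0; lra.
set a := _ ^+ m; lra.
Qed.

Lemma gap_sum_ge0 m : 0 <= gap_sum m.
Proof. by apply: sumr_ge0 => i _; apply: exprn_ge0; lra. Qed.

(* By [sum_imb_le], an upper bound for the mean over [w] of 2^-imb S w, for |S| = m. *)
Definition bias m : R := ('C(m, m./2))%:R / 2 ^+ m * gap_sum m.

Lemma bias_sqr_le m : bias m ^+ 2 <= 4 / m.+1%:R.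
Proof.
rewrite /bias exprMn expr_div_n mulrC.
apply: ler_pM.
- exact: sqr_ge0.
- by rewrite -expr_div_n sqr_ge0.
- rewrite (_ : 4 = 2 ^+ 2); last by rewrite expr2; lra.
  rewrite ler_pXn2r ?nnegrE ?gap_sum_ge0 ?ler0n //.
  apply: le_trans (gap_sum_le m) _.
  by have : 0 <= 2^-1 ^+ m :> R by [apply: exprn_ge0; lra]; lra.
rewrite -exprM mulnC exprM (_ : 2 ^+ 2 = 4%:R); last by rewrite expr2; lra.
rewrite ler_pdivrMr ?exprn_gt0 ?ltr0n // mulrC ler_pdivlMr ?ltr0n //.
by rewrite -!natrX -natrM ler_nat mid_bin_sqr.
Qed.

(** A bound exponential in log m, to match [decay]. For m <= 3 the estimate 4 / (m + 1) is too weak,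
    so these values are computed exactly. *)
Lemma bias_sqr m : (0 < m)%N -> bias m ^+ 2 <= (15 / 16) ^+ (trunc_log 2 m).+1.
Proof.
move=> m_gt0.
have lb := trunc_logP (isT : 1 < 2)%N m_gt0.
have ub := trunc_log_ltn m (isT : 1 < 2)%N.
move: lb ub; set t := trunc_log 2 m => lb ub.
have gen : bias m ^+ 2 <= 4 / (2 ^ t).+1%:R.
  apply: le_trans (bias_sqr_le m) _.
  by rewrite ler_pM2l ?ltr0n // lef_pV2 ?posrE ?ltr0n // ler_nat.
have [m1|[m2|[m3|m_ge4]]] : m = 1%N \/ m = 2%N \/ m = 3%N \/ (4 <= m)%N by lia.
- rewrite (_ : t = 0%N); last by rewrite /t m1.
  by rewrite m1 /bias gap_sum1 bin0 !exprS !expr0; lra.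
- rewrite (_ : t = 1%N); last by rewrite /t m2.
  by rewrite m2 /bias gap_sumSS gap_sum0 bin1 !exprS !expr0; lra.
- rewrite (_ : t = 1%N); last by rewrite /t m3.
  by rewrite m3 /bias gap_sumSS gap_sum1 bin1 !exprS !expr0; lra.
have t_ge2 : (2 <= t)%N.
  rewrite ltnNge; apply/negP => t_le.
  by have := leq_pexp2l (isT : 0 < 2)%N (t_le : (t.+1 <= 2)%N); lia.
apply: le_trans gen _; move: t_ge2; clear; case: t => [|[|[|[|j]]]] // _.
(* The successor in the denominator matters here: 4/5 is below (15/16)^3 but 4/4 is not. *)
- by rewrite (_ : (2 ^ 2).+1 = 5)%N // !exprS !expr0; lra.
- by rewrite (_ : (2 ^ 3).+1 = 9)%N // !exprS !expr0; lra.
rewrite ler_pdivrMr ?ltr0n //.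
apply: (@le_trans _ _ ((15 / 16) ^+ j.+4.+1 * 2 ^+ j.+4)); last first.
  apply: ler_wpM2l; first by apply: exprn_ge0; lra.
  by rewrite -natrX ler_nat.
rewrite exprS -mulrA -exprMn !exprS.
have : 1 <= (15 / 16 * 2) ^+ j :> R by apply: exprn_ege1; lra.
by set a := _ ^+ j; lra.
Qed.
End Bias.

(** * Averages over all subsets of a finite set *)

Section Average.
Variables (R : realFieldType) (T : finType).
Implicit Types S w : {set T}.

Definition imb S w : nat := gap #|S :&: w| #|S :\: w|.

Lemma card_trace S k :
  (#|[set w | #|S :&: w| == k]| <= 'C(#|S|, k) * 2 ^ (#|T| - #|S|))%N.
Proof.
pose f w := (S :&: w, w :\: S).
have f_inj : injective f.
  move=> w1 w2 [e1 e2]; rewrite -(setID w1 S) -(setID w2 S) e2.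
  by rewrite setIC e1 setIC.
have -> : (#|T| - #|S| = #|~: S|)%N by rewrite [RHS]cardsCs setCK.
rewrite -(card_imset _ f_inj) -cards_draws -card_powerset -cardsX.
apply: subset_leq_card; apply/subsetP => _ /imsetP[w + ->].
by rewrite !inE /= => ->; rewrite subsetIl subsetDr.
Qed.

(** The sets [w] are grouped by k = [#|S :&: w|]. By [card_trace] each class is small, and its
    binomial is replaced by the middle one, which leaves [gap_sum]. *)
Lemma sum_imb_le S :
  \sum_w 2^-1 ^+ imb S w <= 2 ^+ #|T| * bias R #|S|.
Proof.
set m := #|S|.
have le_m w : (#|S :&: w| < m.+1)%N by rewrite ltnS subset_leq_card ?subsetIl.
rewrite (partition_big (fun w => Ordinal (le_m w)) xpredT) //=.
rewrite /bias /gap_sum mulrA mulr_sumr; apply: ler_sum => k _.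
rewrite (eq_bigr (fun=> 2^-1 ^+ gap k (m - k))); last first.
  move=> w /eqP <- /=; congr (_ ^+ gap _ _).
  by rewrite cardsD.
rewrite sumr_const -[leLHS]mulr_natl; apply: ler_wpM2r; first by apply: exprn_ge0; lra.
have le_mT : (m <= #|T|)%N by rewrite max_card.
rewrite -{1}(subnK le_mT) exprD -mulrA [X in _ * X]mulrCA mulfV ?expf_neq0 ?pnatr_eq0 //.
rewrite mulr1 mulrC -natrX -natrM ler_nat.
apply: leq_trans (_ : _ <= 'C(m, k) * 2 ^ (#|T| - m))%N _; last first.
  by rewrite leq_mul2r bin_le_mid orbT.
apply: leq_trans (card_trace S k); rewrite -cardsE.
by apply: subset_leq_card; apply/subsetP => w; rewrite !inE.
Qed.

(* Independence of the traces of [w] on [S1] and [S2], by exchanging the traces of two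
   sets [w] and [w'] on [S1]. *)
Lemma sum_indep S1 S2 (F G : {set T} -> R) :
  [disjoint S1 & S2] ->
  (forall w w', S1 :&: w = S1 :&: w' -> F w = F w') ->
  (forall w w', S2 :&: w = S2 :&: w' -> G w = G w') ->
  2 ^+ #|T| * \sum_w F w * G w = (\sum_w F w) * (\sum_w G w).
Proof.
move=> dis hF hG.
pose mix (w w' : {set T}) := S1 :&: w :|: w' :\: S1.
pose sw (p : {set T} * {set T}) := (mix p.1 p.2, mix p.2 p.1).
have swK : involutive sw.
  move=> [w w']; rewrite /sw /mix /=; congr (_, _); apply/setP => x;
  by rewrite !inE; case: (x \in S1); case: (x \in w); case: (x \in w').
rewrite big_distrlr /= pair_big /= (reindex_inj (inv_inj swK)) /=.
rewrite (eq_bigr (fun p => F p.1 * G p.1)); last first.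
  move=> [w w'] _ /=; congr (_ * _); [apply: hF|apply: hG]; apply/setP => x;
  rewrite !inE; have := disjointFr dis (x := x); case: (x \in S1) => /=;
  rewrite ?andbF ?andbT ?orbF //.
  by move=> /(_ isT) ->.
rewrite -(pair_big xpredT xpredT (fun w w' => F w * G w)) /= mulr_sumr.
apply: eq_bigr => w _; rewrite sumr_const -natrX mulr_natl; congr (_ *+ _).
by rewrite -cardsT -card_powerset powersetT cardsT.
Qed.
End Average.

(** * Relative rank *)

Lemma mxvec_index_inj m n (i i' : 'I_m) (j j' : 'I_n) :
  (mxvec_index i j == mxvec_index i' j') = (i == i') && (j == j').
Proof.
rewrite -xpair_eqE; apply/eqP/eqP => [|[-> ->] //].
have [g gK _] := curry_mxvec_bij m n.
move=> e; have := gK (i, j) isT; rewrite /= e.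
by have := gK (i', j') isT => /= -> <-.
Qed.

Section Rank.
Variable F : fieldType.

(** Row i depends only on [f i], so [M] factors through a space of dimension [#|A|]. *)
Lemma mxrank_le_card (T : finType) (A : {set T}) m p (M : 'M[F]_(m, p))
    (f : 'I_m -> T) (N : T -> 'I_p -> F) :
  (forall i, f i \in A) -> (forall i j, M i j = N (f i) j) ->
  (\rank M <= #|A|)%N.
Proof.
move=> fA MN.
pose P : 'M[F]_(m, #|A|) := \matrix_(i, k) (enum_val k == f i)%:R.
pose Q : 'M[F]_(#|A|, p) := \matrix_(k, j) N (enum_val k) j.
suff -> : M = P *m Q by apply: mulmx_max_rank.
apply/matrixP => i j; rewrite mxE MN.
rewrite (eq_bigr (fun k => (enum_val k == f i)%:R * N (enum_val k) j)); last first.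
  by move=> k _; rewrite !mxE.
rewrite -(big_enum_val (fun x => (x == f i)%:R * N x j)) (bigD1 (f i)) //= eqxx mul1r.
by rewrite big1 ?addr0 // => x /andP[_ /negPf ->]; rewrite mul0r.
Qed.

(** The rank factorizations of [A] and [B] multiply to a factorization of [M] through pairs of
    indices. *)
Lemma mxrank_hadamard m p (A B M : 'M[F]_(m, p)) :
  (forall i j, M i j = A i j * B i j) -> (\rank M <= \rank A * \rank B)%N.
Proof.
move=> MAB.
pose P : 'M[F]_(m, #|{: 'I_(\rank A) * 'I_(\rank B)}|) :=
  \matrix_(i, k) (col_base A i (enum_val k).1 * col_base B i (enum_val k).2).
pose Q : 'M[F]_(#|{: 'I_(\rank A) * 'I_(\rank B)}|, p) :=
  \matrix_(k, j) (row_base A (enum_val k).1 j * row_base B (enum_val k).2 j).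
suff -> : M = P *m Q.
  by apply: leq_trans (mulmx_max_rank _ _) _; rewrite card_prod !card_ord.
apply/matrixP => i j; rewrite mxE MAB -{1}(mulmx_base A) -{1}(mulmx_base B) !mxE.
rewrite big_distrlr /= pair_big /=.
rewrite [LHS](big_enum_val (A := predT)).
by apply: eq_bigr => k _; rewrite !mxE mulrACA.
Qed.

End Rank.

(** * Block degrees and coefficients of set-multilinear products *)

Section Counts.
Variables (n d : nat) (F : fieldType).
Implicit Types (p q : {mpoly F[n * d]}) (S T : {set 'I_d}) (c : 'I_d -> nat)
  (g : {ffun 'I_d -> 'I_n}) (m : 'X_{1..n * d}).

(** Degrees above 1 are allowed, so that the notion is stable under products even when the factors
    share a block. *)
Definition col_degree c p :=
  forall m, m \in msupp p -> forall j, (\sum_(i < n) m (mxvec_index i j))%N = c j.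

Lemma set_multilinearP S p :
  reflect (col_degree (fun j => j \in S) p) (set_multilinear S p).
Proof.
apply: (iffP allP) => H m mp.
  by move=> j; apply/eqP; move/forallP: (H m mp); apply.
by apply/forallP => j; apply/eqP; apply: H.
Qed.

Lemma col_degreeM c1 c2 p q :
  col_degree c1 p -> col_degree c2 q -> col_degree (fun j => c1 j + c2 j)%N (p * q).
Proof.
move=> h1 h2 m /msuppM_le /allpairsP[[m1 m2] /= [mp mq ->]] j.
by rewrite -(h1 _ mp) -(h2 _ mq) -big_split; apply: eq_bigr => i _; rewrite mnmDE.
Qed.

Lemma col_degree_uniq c1 c2 p : p != 0 -> col_degree c1 p -> col_degree c2 p -> c1 =1 c2.
Proof.
rewrite -msupp_eq0; case E : (msupp p) => [//|m s] _ h1 h2 j.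
have mp : m \in msupp p by rewrite E mem_head.
by rewrite -(h1 m mp) (h2 m mp).
Qed.

Definition mon S g : 'X_{1..n * d} := (\sum_(j in S) U_(mxvec_index (g j) j))%MM.

Lemma monE S g i j : mon S g (mxvec_index i j) = (j \in S) && (g j == i) :> nat.
Proof.
rewrite mnm_sumE; have [jS|jS] := boolP (j \in S).
  rewrite (bigD1 j) //= mnm1E mxvec_index_inj eqxx andbT big1 ?addn0 // => l /andP[_ ne].
  by rewrite mnm1E mxvec_index_inj (negPf ne) andbF.
rewrite big1 // => l lS; rewrite mnm1E mxvec_index_inj.
by have [e|] := eqVneq l j; [rewrite -e lS in jS | rewrite andbF].
Qed.

Lemma mon_count S g j : (\sum_(i < n) mon S g (mxvec_index i j))%N = (j \in S).
Proof.
rewrite (eq_bigr (fun i => ((j \in S) && (g j == i) : nat))); last by move=> i _; rewrite monE.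
have [jS|jS] := boolP (j \in S); last by rewrite big1.
by rewrite (bigD1 (g j)) //= eqxx big1 // => i; rewrite eq_sym => /negPf ->.
Qed.

Lemma eq_mon S g g' : {in S, g =1 g'} -> mon S g = mon S g'.
Proof. by move=> e; apply: eq_bigr => j jS; rewrite e. Qed.

Lemma mcoeff_mon0 c S g p j :
  col_degree c p -> c j != (j \in S) -> p@_(mon S g) = 0.
Proof.
move=> h ne; apply: memN_msupp_eq0; apply: contra ne => mp.
by rewrite -(h _ mp) mon_count.
Qed.

Lemma monU S T g : [disjoint S & T] -> mon (S :|: T) g = (mon S g + mon T g)%MM.
Proof. by move=> dis; rewrite -bigU //; apply: eq_bigl => j; rewrite !inE. Qed.

(** Block j of [mon T g] holds at most the variable x_(g j, j), so a divisor is determined by its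
    block degrees. *)
Lemma mon_dvd S T g m1 m2 :
  mon T g = (m1 + m2)%MM ->
  (forall j, (\sum_(i < n) m1 (mxvec_index i j))%N = (j \in S)) -> m1 = mon S g.
Proof.
move=> e h; apply/mnmP => k; case/mxvec_indexP: k => i j; rewrite monE.
have le i' : (m1 (mxvec_index i' j) <= (g j == i'))%N.
  have := monE T g i' j; rewrite e mnmDE.
  by case: (g j == i'); case: (j \in T) => /=; lia.
have [gi|gi] := eqVneq (g j) i; last first.
  by rewrite andbF; apply/eqP; rewrite -leqn0; have := le i; rewrite (negPf gi).
rewrite andbT -(h j) -gi (bigD1 (g j)) //= big1 ?addn0 // => i' ne.
by apply/eqP; rewrite -leqn0; have := le i'; rewrite eq_sym (negPf ne).
Qed.

(** By [mon_dvd] the monomial splits in only one way compatible with the two supports, so a single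
    term of the convolution survives. *)
Lemma mcoeffM_mon S T g p q : [disjoint S & T] ->
  set_multilinear S p -> set_multilinear T q ->
  (p * q)@_(mon (S :|: T) g) = p@_(mon S g) * q@_(mon T g).
Proof.
move=> dis /set_multilinearP hp /set_multilinearP hq.
set M := mon _ g; rewrite mcoeffM.
have MU : M = (mon S g + mon T g)%MM by apply: monU.
have l1 : (mdeg (mon S g) < (mdeg M).+1)%N by rewrite MU mdegD ltnS leq_addr.
have l2 : (mdeg (mon T g) < (mdeg M).+1)%N by rewrite MU mdegD ltnS leq_addl.
rewrite (bigD1 (BMultinom l1, BMultinom l2)) /=; last by rewrite MU.
rewrite big1 ?addr0 // => -[k1 k2] /= /andP[/eqP e ne].
apply/eqP; apply: contraNT ne; rewrite mulf_eq0 negb_or -!mcoeff_msupp => /andP[s1 s2].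
rewrite xpair_eqE; apply/andP; split; apply/eqP/val_inj.
  exact: mon_dvd e (hp _ s1).
by rewrite addmC in e; apply: mon_dvd e (hq _ s2).
Qed.

End Counts.

(** * Relative rank with respect to a bipartition of the blocks *)

Section RelRank.
Variables (R : rcfType) (n d : nat) (F : fieldType) (D : {set 'I_d}) (i0 : 'I_n).
Hypothesis n_ge4 : (4 <= n)%N.
Implicit Types (p q : {mpoly F[n * d]}) (S T w : {set 'I_d}) (a b g : {ffun 'I_d -> 'I_n}).

(* Outside [D] only the variables x_(i0, j) are kept, which amounts to setting them to 1 and
   the other ones of these blocks to 0; it serves to drop one block when [d] is odd. *)
Definition mix w a b : {ffun 'I_d -> 'I_n} :=
  [ffun j => if j \in D then (if j \in w then a j else b j) else i0].

(** Rows and columns range over all choice functions, so rows and columns are repeated; this does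
    not change the rank. *)
Definition coef_mx w S p : 'M[F]_#|{ffun 'I_d -> 'I_n}| :=
  \matrix_(k, l) p@_(mon S (mix w (enum_val k) (enum_val l))).

(** A block off [D] offers a single variable, hence only blocks of [D] enter the normalization. *)
Definition relrank w S p : R :=
  (\rank (coef_mx w S p))%:R / Num.sqrt n%:R ^+ #|S :&: D|.

Let s : R := Num.sqrt n%:R.
Let s_ge2 : 2 <= s.
Proof.
rewrite (_ : 2 = Num.sqrt (2 ^+ 2)); last by rewrite sqrtr_sqr ger0_norm.
by rewrite ler_wsqrtr // -natrX ler_nat.
Qed.
Let s_gt0 : 0 < s. Proof. by apply: lt_le_trans s_ge2. Qed.

Lemma relrank_ge0 w S p : 0 <= relrank w S p.
Proof. by rewrite divr_ge0 ?ler0n ?exprn_ge0 ?sqrtr_ge0. Qed.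

Lemma relrank0 w S : relrank w S 0 = 0.
Proof.
rewrite /relrank (_ : coef_mx w S 0 = 0) ?mxrank0 ?mul0r //.
by apply/matrixP => k l; rewrite !mxE mcoeff0.
Qed.

Lemma relrank_eq0 c w S p j : col_degree c p -> c j != (j \in S) -> relrank w S p = 0.
Proof.
move=> h ne; rewrite /relrank (_ : coef_mx w S p = 0) ?mxrank0 ?mul0r //.
by apply/matrixP => k l; rewrite !mxE (mcoeff_mon0 _ h ne).
Qed.

Lemma relrankD w S p q : relrank w S (p + q) <= relrank w S p + relrank w S q.
Proof.
rewrite /relrank -mulrDl; apply: ler_wpM2r.
  by rewrite invr_ge0 exprn_ge0 ?sqrtr_ge0.
rewrite -natrD ler_nat.
suff -> : coef_mx w S (p + q) = coef_mx w S p + coef_mx w S q by apply: mxrank_add.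
by apply/matrixP => k l; rewrite !mxE mcoeffD.
Qed.

(** On disjoint supports the coefficient matrix of a product is the entrywise product of the two
    matrices. *)
Lemma relrankM w S T p q : [disjoint S & T] ->
  set_multilinear S p -> set_multilinear T q ->
  relrank w (S :|: T) (p * q) <= relrank w S p * relrank w T q.
Proof.
move=> dis hp hq; rewrite /relrank mulrACA -invfM -exprD.
have -> : (#|S :&: D| + #|T :&: D| = #|(S :|: T) :&: D|)%N.
  rewrite setIUl cardsU (_ : S :&: D :&: (T :&: D) = set0) ?cards0 ?subn0 //.
  by rewrite setIACA (disjoint_setI0 dis) set0I.
apply: ler_wpM2r; first by rewrite invr_ge0 exprn_ge0 ?sqrtr_ge0.
rewrite -natrM ler_nat; apply: mxrank_hadamard => k l.
by rewrite !mxE mcoeffM_mon.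
Qed.

(** This dependence on a trace of [w] alone is what [sum_indep] requires. *)
Lemma eq_relrank S p w w' : S :&: D :&: w = S :&: D :&: w' -> relrank w S p = relrank w' S p.
Proof.
move=> e; rewrite /relrank; suff -> : coef_mx w S p = coef_mx w' S p by [].
apply/matrixP => k l; rewrite !mxE; congr (_@__); apply: eq_mon => j jS.
by rewrite !ffunE; have /setP/(_ j) := e; rewrite !inE jS; case: (j \in D) => //= ->.
Qed.

(** Resetting a choice function to [i0] off [E] leaves its row unchanged, and only n^|E| functions
    remain. *)
Lemma rank_le_supp (E : {set 'I_d}) (M : 'M[F]_#|{ffun 'I_d -> 'I_n}|)
    (N : {ffun 'I_d -> 'I_n} -> {ffun 'I_d -> 'I_n} -> F) :
  (forall k l, M k l = N (enum_val k) (enum_val l)) ->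
  (forall a a' b, {in E, a =1 a'} -> N a b = N a' b) ->
  (\rank M <= n ^ #|E|)%N.
Proof.
move=> MN NE.
pose f (k : 'I_#|{ffun 'I_d -> 'I_n}|) : {ffun 'I_d -> 'I_n} :=
  [ffun j => if j \in E then (enum_val k : {ffun 'I_d -> 'I_n}) j else i0].
have -> : (n ^ #|E| = #|[set g in pffun_on i0 (mem E) (mem 'I_n)]|)%N.
  by rewrite cardsE card_pffun_on card_ord.
apply: (@mxrank_le_card F _ _ _ _ M f (fun a l => N a (enum_val l))) => [k|k l].
  rewrite inE; apply/pffun_onP; split => //.
  by apply/subsetP => j; rewrite inE ffunE; case: ifP => // _; rewrite eqxx.
by rewrite MN; apply: NE => j jE; rewrite ffunE jE.
Qed.

Lemma rank_coef_mx_row w S p : (\rank (coef_mx w S p) <= n ^ #|S :&: D :&: w|)%N.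
Proof.
apply: (@rank_le_supp _ _ (fun a b => p@_(mon S (mix w a b)))) => [k l|a a' b e].
  by rewrite mxE.
congr (_@__); apply: eq_mon => j jS; rewrite !ffunE.
by have := e j; rewrite !inE jS; case: (j \in D) => //=; case: (j \in w) => //= ->.
Qed.

Lemma rank_coef_mx_col w S p : (\rank (coef_mx w S p) <= n ^ #|S :&: D :\: w|)%N.
Proof.
rewrite -mxrank_tr.
apply: (@rank_le_supp _ _ (fun b a => p@_(mon S (mix w a b)))) => [k l|a a' b e].
  by rewrite !mxE.
congr (_@__); apply: eq_mon => j jS; rewrite !ffunE.
by have := e j; rewrite !inE jS; case: (j \in D) => //=; case: (j \in w) => //= ->.
Qed.

(** If the two sides have x <= y blocks, the rank is at most n^x and the normalization is n^((x + y)
    / 2). The quotient n^(-(y - x) / 2) is at most 2^-(y - x) because n >= 4. *)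
Lemma relrank_le_imb w S p : relrank w S p <= 2^-1 ^+ imb (S :&: D) w.
Proof.
have key x y : (\rank (coef_mx w S p) <= n ^ x)%N -> (x <= y)%N ->
    (#|S :&: D| = x + y)%N -> relrank w S p <= 2^-1 ^+ (y - x).
  move=> rk le_xy E; rewrite /relrank -/s E -{1}(subnKC le_xy) addnA exprD invfM mulrA.
  rewrite exprVn -[leRHS]mul1r; apply: ler_pM.
  - by rewrite divr_ge0 ?ler0n // exprn_ge0 ?ltW.
  - by rewrite invr_ge0 exprn_ge0 ?ltW.
  - rewrite ler_pdivrMr ?exprn_gt0 // mul1r addnn -mul2n exprM sqr_sqrtr ?ler0n //.
    by rewrite -natrX ler_nat.
  - by rewrite lef_pV2 ?posrE ?exprn_gt0 ?ltr0n // lerXn2r ?nnegrE ?ler0n // ltW.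
have E := esym (cardsID w (S :&: D)).
case: (leqP #|S :&: D :&: w| #|S :&: D :\: w|) => le.
  rewrite (_ : imb _ _ = #|S :&: D :\: w| - #|S :&: D :&: w|)%N.
    exact: key (rank_coef_mx_row _ _ _) le E.
  by rewrite /imb /gap; lia.
rewrite (_ : imb _ _ = #|S :&: D :&: w| - #|S :&: D :\: w|)%N.
  by apply: key (rank_coef_mx_col _ _ _) (ltnW le) _; rewrite addnC.
by rewrite /imb /gap; lia.
Qed.

Lemma relrank_le1 w S p : relrank w S p <= 1.
Proof.
apply: le_trans (relrank_le_imb w S p) _; apply: exprn_ile1; lra.
Qed.

End RelRank.

(** * Mean relative rank of a formula *)

Section FormulaInd.
Variables (n d : nat) (F : fieldType) (P : formula n d F -> Prop).
Let Ps s := foldr (fun G A => P G /\ A) True s.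
Hypothesis P_var : forall i j, P (FVar F i j).
Hypothesis P_const : forall a, P (FConst n d a).
Hypothesis P_add : forall s, Ps s -> P (FAdd s).
Hypothesis P_mul : forall s, Ps s -> P (FMul s).

(* The automatic induction principle ignores the children of a node. *)
Fixpoint formula_nested_ind (G : formula n d F) : P G :=
  let fix all_ind s : Ps s :=
    if s is G :: s' then conj (formula_nested_ind G) (all_ind s') else I in
  match G with
  | FVar i j => P_var i j
  | FConst a => P_const a
  | FAdd s => P_add (all_ind s)
  | FMul s => P_mul (all_ind s)
  end.
End FormulaInd.

Section Potential.
Variables (R : rcfType) (n d : nat) (F : fieldType) (D : {set 'I_d}) (i0 : 'I_n).
Hypothesis n_ge4 : (4 <= n)%N.
(** [B m] is the bound on the mean for m blocks, per unit of formula size. [B_merge] is the product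
    step: the larger factor is controlled by [B], the smaller one by [bias]. *)
Variable B : nat -> R.
Hypothesis B_ge0 : forall m, 0 <= B m.
Hypothesis B_small : forall m, (m <= 1)%N -> B m = 1.
Hypothesis B_merge : forall m1 m2, (m2 <= m1)%N -> B m1 * bias R m2 <= B (m1 + m2)%N.
Implicit Types (p q : {mpoly F[n * d]}) (S T w : {set 'I_d}) (s t : nat).

Local Notation relrank := (relrank R D i0).

(** Quantifying over every [S] makes sums additive without a common support: for an [S] that does
    not match the block degrees the rank is 0. The factor 2^d counts the sets [w]. *)
Definition bounded s p := forall S, \sum_w relrank w S p <= 2 ^+ d * (s%:R * B #|S :&: D|).

Lemma bounded0 s : bounded s 0.
Proof.
move=> S; rewrite big1 => [|w _]; last exact: relrank0.
by rewrite mulr_ge0 ?exprn_ge0 ?mulr_ge0 ?ler0n.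
Qed.

Lemma bounded_le s t p : (s <= t)%N -> bounded s p -> bounded t p.
Proof.
move=> le_st h S; apply: le_trans (h S) _.
by apply: ler_wpM2l; rewrite ?exprn_ge0 ?ler0n // ler_wpM2r ?ler_nat.
Qed.

Lemma boundedD s t p q : bounded s p -> bounded t q -> bounded (s + t) (p + q).
Proof.
move=> hp hq S; rewrite natrD mulrDl mulrDr.
apply: le_trans (lerD (hp S) (hq S)); rewrite -big_split.
by apply: ler_sum => w _; apply: relrankD.
Qed.

Lemma bounded_count c s p : col_degree c p ->
  (forall S, (forall j, c j = (j \in S)) ->
     \sum_w relrank w S p <= 2 ^+ d * (s%:R * B #|S :&: D|)) -> bounded s p.
Proof.
move=> hc h S; have [/forallP e|] := boolP [forall j, c j == (j \in S)].
  by apply: h => j; apply/eqP.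
rewrite negb_forall => /existsP[j ne].
rewrite big1 => [|w _]; last exact: relrank_eq0 hc ne.
by rewrite mulr_ge0 ?exprn_ge0 ?mulr_ge0 ?ler0n.
Qed.

Lemma bounded_small S p : set_multilinear S p -> (#|S| <= 1)%N -> bounded 1 p.
Proof.
move=> /set_multilinearP hp S_le1; apply: (bounded_count hp) => T eST.
have {T eST} -> : T = S.
  by apply/setP => j; have := eST j; case: (j \in S); case: (j \in T).
rewrite B_small; last by apply: leq_trans S_le1; rewrite subset_leq_card ?subsetIl.
apply: (@le_trans _ _ (\sum_(w : {set 'I_d}) 1)).
  by apply: ler_sum => w _; apply: relrank_le1.
rewrite sumr_const !mulr1 -natrX ler_nat -cardsT -powersetT card_powerset cardsT.
by rewrite card_ord.
Qed.

(** The traces of [w] on the two supports are independent, so the mean of the product of ranks is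
    the product of the means. Only the factor with more blocks in [D] uses its inductive bound. *)
Lemma sum_relrankM S T p q s :
  [disjoint S & T] -> set_multilinear S p -> set_multilinear T q -> bounded s p ->
  (#|T :&: D| <= #|S :&: D|)%N ->
  \sum_w relrank w (S :|: T) (p * q) <= 2 ^+ d * (s%:R * B #|(S :|: T) :&: D|).
Proof.
move=> dis hp hq bp le.
have disD : [disjoint S :&: D & T :&: D].
  by rewrite -setI_eq0 setIACA (disjoint_setI0 dis) set0I.
have -> : #|(S :|: T) :&: D| = (#|S :&: D| + #|T :&: D|)%N.
  by rewrite setIUl cardsU (disjoint_setI0 disD) cards0 subn0.
have d_gt0 : 0 < 2 ^+ d :> R by rewrite exprn_gt0 ?ltr0n.
rewrite -(ler_pM2l d_gt0).
apply: (@le_trans _ _ ((\sum_w relrank w S p) * (\sum_w relrank w T q))).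
  have -> := esym (sum_indep disD (fun w w' => @eq_relrank R n d F D i0 S p w w')
    (fun w w' => @eq_relrank R n d F D i0 T q w w')).
  rewrite card_ord ler_pM2l //; apply: ler_sum => w _; exact: relrankM.
apply: (@le_trans _ _ (2 ^+ d * (s%:R * B #|S :&: D|) * (2 ^+ d * bias R #|T :&: D|))).
  apply: ler_pM (bp S) _; try by apply: sumr_ge0 => w _; apply: relrank_ge0.
  have := sum_imb_le R (T :&: D); rewrite card_ord; apply: le_trans.
  by apply: ler_sum => w _; apply: relrank_le_imb.
rewrite mulrACA [leRHS]mulrA ler_pM2l ?mulr_gt0 // -mulrA ler_wpM2l ?ler0n //.
exact: B_merge.
Qed.

Lemma boundedM S T p q s t :
  [disjoint S & T] -> set_multilinear S p -> set_multilinear T q ->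
  bounded s p -> bounded t q -> bounded (s + t) (p * q).
Proof.
move=> dis hp hq bp bq.
have [hp' hq'] := (elimT (set_multilinearP _ _) hp, elimT (set_multilinearP _ _) hq).
apply: (bounded_count (col_degreeM hp' hq')) => U eU.
have {U eU} -> : U = S :|: T.
  apply/setP => j; have := eU j; rewrite inE.
  by case: (j \in S); case: (j \in T); case: (j \in U).
have [le|/ltnW le] := leqP #|T :&: D| #|S :&: D|.
  apply: le_trans (sum_relrankM dis hp hq bp le) _.
  by apply: ler_wpM2l; rewrite ?exprn_ge0 ?ler0n // ler_wpM2r ?ler_nat ?leq_addr.
rewrite setUC mulrC; rewrite disjoint_sym in dis.
apply: le_trans (sum_relrankM dis hq hp bq le) _.
by apply: ler_wpM2l; rewrite ?exprn_ge0 ?ler0n // ler_wpM2r ?ler_nat ?leq_addl.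
Qed.

Lemma fsize_add (l : seq (formula n d F)) : fsize (FAdd l) = (sumn (map (@fsize n d F) l)).+1.
Proof. by rewrite /fsize /= size_flatten /shape -map_comp. Qed.

Lemma fsize_mul (l : seq (formula n d F)) : fsize (FMul l) = (sumn (map (@fsize n d F) l)).+1.
Proof. by rewrite /fsize /= size_flatten /shape -map_comp. Qed.

Lemma set_multilinear_children (l : seq (formula n d F)) :
  all (fun N => [exists S, set_multilinear S (feval N)]) (flatten (map (@fnodes n d F) l)) ->
  all (@set_multilinear_formula n d F) l.
Proof. by elim: l => //= G l IH; rewrite all_cat => /andP[smG /IH ->]; rewrite andbT. Qed.

Lemma fnodes_self (a : pred (formula n d F)) G : all a (fnodes G) -> a G.
Proof. by case: G => [i j|c|l|l] /= /andP[]. Qed.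

Lemma col_degree_prod (l : seq (formula n d F)) :
  all (@set_multilinear_formula n d F) l ->
  exists c, col_degree c (\prod_(p <- map (@feval n d F) l) p).
Proof.
elim: l => [|G l IH] /=.
  move=> _; exists (fun _ => 0%N) => m; rewrite big_nil msupp1 inE => /eqP -> j.
  by rewrite big1 // => i _; rewrite mnm0E.
move=> /andP[/fnodes_self/existsP[S /set_multilinearP hS] /IH[c hc]].
by exists (fun j => (j \in S) + c j)%N; rewrite big_cons; apply: col_degreeM.
Qed.

(** The product of the tail of [l] is not a node, so its set-multilinearity must be derived: as the
    whole product is nonzero, block degrees add up to 0 or 1, which makes the tail set-multilinear
    on a set disjoint from [S]. The extra 1 pays for the empty product. *)
Lemma bounded_prod (l : seq (formula n d F)) U :
  all (@set_multilinear_formula n d F) l ->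
  foldr (fun G A => (set_multilinear_formula G -> bounded (fsize G) (feval G)) /\ A) True l ->
  let p := \prod_(p <- map (@feval n d F) l) p in
  p != 0 -> set_multilinear U p -> bounded (sumn (map (@fsize n d F) l)).+1 p.
Proof.
elim: l U => [|G l IH] U /=.
  move=> _ _; rewrite big_nil => _ _; apply: (@bounded_small set0); last by rewrite cards0.
  apply/set_multilinearP => m; rewrite msupp1 inE => /eqP -> j.
  by rewrite inE big1 // => i _; rewrite mnm0E.
move=> /andP[smG sml] [/(_ smG) bG bl]; rewrite big_cons mulf_eq0 negb_or => /andP[nzG nzl].
have /existsP[S smS] := fnodes_self smG.
have [c hc] := col_degree_prod sml.
move: nzl hc (fun V => IH V sml bl) => {IH}; set q := \prod_(_ <- _) _ => nzl hc IH.
move=> /set_multilinearP smU; have hS := elimT (set_multilinearP _ _) smS.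
have nz : feval G * q != 0 by rewrite mulf_neq0.
have e := col_degree_uniq nz smU (col_degreeM hS hc).
pose T := [set j | c j == 1%N].
have cT j : c j = (j \in T).
  by rewrite inE; have := e j; case: (j \in S); case: (j \in U); case: (c j) => [|[|k]].
have smT : set_multilinear T q.
  by apply/set_multilinearP => m mq j; rewrite (hc m mq) cT.
rewrite -addnS; apply: boundedM smS smT bG (IH _ nzl smT).
rewrite -setI_eq0; apply/eqP/setP => j; rewrite in_setI in_set0.
by have := e j; rewrite cT; case: (j \in S); case: (j \in T); case: (j \in U).
Qed.

Lemma bounded_formula G : set_multilinear_formula G -> bounded (fsize G) (feval G).
Proof.
elim/formula_nested_ind: G => [i j|a|l IH|l IH].
- move=> /andP[/existsP[S smS] _]; rewrite /= in smS *.
  apply: (bounded_small smS).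
  have /set_multilinearP/(_ U_(mxvec_index i j)%MM) := smS.
  rewrite msuppX inE eqxx => /(_ isT) e.
  suff /eqP -> : S == [set j] by rewrite cards1.
  apply/eqP/setP => k; rewrite inE.
  have := e k; rewrite (eq_bigr (fun l => ((i == l) && (j == k) : nat))); last first.
    by move=> l _; rewrite mnm1E mxvec_index_inj.
  rewrite (bigD1 i) //= eqxx big1 ?addn0; last by move=> l; rewrite eq_sym => /negPf ->.
  by rewrite [k == j]eq_sym; case: (k \in S); case: (j == k).
- move=> _ /=; apply: (@bounded_small set0); last by rewrite cards0.
  apply/set_multilinearP => m; rewrite msuppC; case: ifP => // _; rewrite inE => /eqP -> j.
  by rewrite inE big1 // => i _; rewrite mnm0E.
- rewrite fsize_add => /andP[_ /set_multilinear_children sm] /=.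
  apply: (@bounded_le (sumn (map (@fsize n d F) l))) => //.
  elim: l IH sm => [|G l IHl] /=; first by rewrite big_nil => *; apply: bounded0.
  by move=> [bG bl] /andP[smG sml]; rewrite big_cons; apply: boundedD; [apply: bG|apply: IHl].
rewrite fsize_mul => /andP[/existsP[U smU] /set_multilinear_children sm].
(* A zero product says nothing about the block degrees of its factors, so it is treated apart. *)
have [e|nz] := eqVneq (feval (FMul l)) 0; first by rewrite e; apply: bounded0.
exact: bounded_prod sm IH nz smU.
Qed.

End Potential.

(** * The decay function *)

Section Decay.
Variable R : realType.

(* [rate] is nonincreasing and m * rate m = O(log m), so that decay (m1 + m2) - decay m1 is
   O(log m2) for m2 <= m1, while decay m is of order log^2 m. *)
Definition rate_at (t : nat) : R := t.+1%:R / (64 * 2 ^+ t).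
Definition rate (i : nat) : R := rate_at (trunc_log 2 i).
Definition decay (m : nat) : R := \sum_(1 <= i < m) rate i.

Lemma rate_at_ge0 t : 0 <= rate_at t.
Proof. by rewrite divr_ge0 ?mulr_ge0 ?exprn_ge0 ?ler0n. Qed.

Lemma rate_at_anti t t' : (t <= t')%N -> rate_at t' <= rate_at t.
Proof.
move=> /subnKC <-; elim: (t' - t)%N => [|k IH]; first by rewrite addn0.
apply: le_trans IH; rewrite addnS; move: (t + k)%N => {t t' k} t.
have a_gt0 : 0 < 64 * 2 ^+ t :> R by rewrite mulr_gt0 ?exprn_gt0 ?ltr0n.
rewrite /rate_at exprS (mulrCA 64) invfM mulrA ler_pM2r ?invr_gt0 //.
by rewrite ler_pdivrMr ?ltr0n // -natrM ler_nat; lia.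
Qed.

(** Each of the m2 terms is at most [rate m2], and m2 < 2^(t + 1) for t = [trunc_log 2 m2]. *)
Lemma sum_rate_le m1 m2 : (0 < m2 <= m1)%N ->
  \sum_(m1 <= i < m1 + m2) rate i <= (trunc_log 2 m2).+1%:R / 32.
Proof.
move=> /andP[m2_gt0 le_m]; set t := trunc_log 2 m2.
apply: (@le_trans _ _ (\sum_(m1 <= i < m1 + m2) rate m2)).
  apply: ler_sum_nat => i /andP[le_i _]; apply: rate_at_anti.
  by apply: leq_trunc_log; apply: leq_trans le_i.
rewrite sumr_const_nat addKn -[leLHS]mulr_natl /rate /rate_at -/t.
have := trunc_log_ltn m2 (isT : 1 < 2)%N; rewrite -/t => /ltnW.
rewrite -(ler_nat R) natrX exprS => le2.
have p_gt0 : 0 < 2 ^+ t :> R by rewrite exprn_gt0 ?ltr0n.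
rewrite mulrA ler_pdivrMr ?mulr_gt0 ?ltr0n //.
move: p_gt0 le2; set a := 2 ^+ t; set x := m2%:R; set y := t.+1%:R => a_gt0 le2.
have y_ge0 : 0 <= y by rewrite ler0n.
nra.
Qed.

Lemma decay_cat m1 m2 : (0 < m1 <= m2)%N ->
  decay m2 = decay m1 + \sum_(m1 <= i < m2) rate i.
Proof. by move=> /andP[m1_gt0 le]; rewrite /decay (big_cat_nat _ le). Qed.

Lemma decay_le m1 m2 : (m1 <= m2)%N -> decay m1 <= decay m2.
Proof.
case: m1 => [_|m1 le]; last first.
  rewrite (@decay_cat m1.+1 m2) // lerDl.
  by apply: sumr_ge0 => i _; apply: rate_at_ge0.
by rewrite {1}/decay big_geq //; apply: sumr_ge0 => i _; apply: rate_at_ge0.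
Qed.

(** The 2^t indices of the dyadic block from 2^t to 2^(t + 1) contribute (t + 1) / 64 in total. *)
Lemma decay_pow2 t : decay (2 ^ t) = t%:R * t.+1%:R / 128.
Proof.
elim: t => [|t IH]; first by rewrite /decay big_geq // !mul0r.
rewrite (@decay_cat (2 ^ t) (2 ^ t.+1)); last by rewrite expn_gt0 leq_exp2l ?leqnSn.
rewrite IH (eq_big_nat _ _ (F2 := fun=> rate_at t)); last first.
  by move=> i le_i; rewrite /rate (trunc_log_eq _ le_i).
rewrite sumr_const_nat -[X in _ + X]mulr_natl expnS mul2n -addnn addnK /rate_at natrX.
have p_neq0 : 2 ^+ t != 0 :> R by rewrite expf_neq0 ?pnatr_eq0.
by rewrite -[t.+2%:R]natr1 -[t.+1%:R]natr1; field.
Qed.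

Lemma decay_ge m : (0 < m)%N ->
  (trunc_log 2 m)%:R * (trunc_log 2 m).+1%:R / 128 <= decay m.
Proof.
by move=> m_gt0; rewrite -decay_pow2; apply: decay_le; apply: trunc_logP.
Qed.

Definition potential m : R := expR (- decay m).

Lemma potential_small m : (m <= 1)%N -> potential m = 1.
Proof. by move=> le; rewrite /potential /decay big_geq // oppr0 expR0. Qed.

Lemma bias_ge0 m : 0 <= bias R m.
Proof. by rewrite mulr_ge0 ?gap_sum_ge0 // divr_ge0 ?exprn_ge0 ?ler0n. Qed.

(** The square root of [bias_sqr], with 15/16 = 1 - 1/16 <= exp(-1/16). *)
Lemma bias_le m : (0 < m)%N -> bias R m <= expR (- ((trunc_log 2 m).+1%:R / 32)).
Proof.
move=> m_gt0; rewrite -ler_sqr ?nnegrE ?bias_ge0 ?expR_ge0 //.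
apply: le_trans (bias_sqr R m_gt0) _; rewrite -expRM_natl.
set t := trunc_log 2 m.
rewrite (_ : 2%:R * _ = (t.+1)%:R * (- (1 / 16))); last by lra.
rewrite expRM_natl; apply: lerXn2r; rewrite ?nnegrE ?expR_ge0 //; first by lra.
by apply: le_trans (expR_ge1Dx _); lra.
Qed.

(** The exponent 1/32 of [bias_le] pays exactly for the growth of [decay] allowed by
    [sum_rate_le]. *)
Lemma potential_merge m1 m2 : (m2 <= m1)%N ->
  potential m1 * bias R m2 <= potential (m1 + m2).
Proof.
case: m2 => [_|m2 le].
  by rewrite addn0 /bias gap_sum0 bin0 expr0 divr1 !mulr1.
apply: le_trans (ler_wpM2l (expR_ge0 _) (bias_le (ltn0Sn m2))) _.
rewrite /potential -expRD ler_expR (@decay_cat m1 (m1 + m2.+1)); last first.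
  by rewrite leq_addr andbT; apply: leq_trans le.
have := @sum_rate_le m1 m2.+1 le; lra.
Qed.

End Decay.

(** * The Nisan-Wigderson polynomial *)

Section NisanWigderson.
Variables (n d : nat) (K : finFieldType) (phi : 'I_n -> K) (psi : K -> 'I_n).
Variables (F : fieldType) (hdn : (d <= n)%N).
Hypotheses (phiK : cancel phi psi) (psiK : cancel psi phi).
Implicit Types (p q : {poly K}) (S w D : {set 'I_d}) (g : {ffun 'I_d -> 'I_n}).

Let pt (j : 'I_d) : K := phi (widen_ord hdn j).

Let pt_inj : injective pt.
Proof. by move=> i j /(can_inj phiK) /(congr1 val) e; apply: val_inj. Qed.

Definition values p : {ffun 'I_d -> 'I_n} := [ffun j => psi p.[pt j]].

Lemma eq_values p q j : values p j = values q j -> p.[pt j] = q.[pt j].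
Proof. by rewrite !ffunE => /(can_inj psiK). Qed.

Lemma interpolation_uniq S p q : (size p <= #|S|)%N -> (size q <= #|S|)%N ->
  {in S, values p =1 values q} -> p = q.
Proof.
move=> hp hq e; apply/eqP; rewrite -subr_eq0; apply/eqP.
apply: (@roots_geq_poly_eq0 _ _ [seq pt j | j <- enum S]).
- apply/allP => _ /mapP[j jS ->]; rewrite mem_enum in jS.
  by rewrite rootE !hornerE (eq_values (e j jS)) subrr.
- by rewrite map_inj_uniq ?enum_uniq.
- by rewrite size_map -cardE (leq_trans (size_polyD _ _)) // size_polyN geq_max hp.
Qed.

Lemma NW_mon : NW hdn phi psi F =
  \sum_(f : {poly_(uphalf d) K}) 'X_[mon setT (values (val f))].
Proof.
apply: eq_bigr => f _; rewrite /xvar mprodXE; congr 'X_[_].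
by apply: eq_big => [j|j _]; rewrite ?inE ?ffunE.
Qed.

Lemma mon_inj g g' : mon setT g = mon setT g' -> g = g'.
Proof.
move=> e; apply/ffunP => j.
by have := monE setT g' (g j) j; rewrite -e monE inE eqxx; case: eqP.
Qed.

Lemma mcoeff_NW g : (NW hdn phi psi F)@_(mon setT g) =
  \sum_(f : {poly_(uphalf d) K}) (values (val f) == g)%:R.
Proof.
rewrite NW_mon raddf_sum; apply: eq_bigr => f _ /=; rewrite mcoeffX.
by congr (_%:R); congr (nat_of_bool _); apply/eqP/eqP => [/mon_inj|->].
Qed.

(* The factor vanishing off [D] forces the value [psi 0] there, so that the
   remaining [h] coefficients are determined on either half of [D]. *)
Lemma rank_coef_mx_NW D w :
  #|D| = (d./2).*2 -> #|D :&: w| = d./2 ->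
  (#|K| ^ d./2 <= \rank (coef_mx D (psi 0%R) w setT (NW hdn phi psi F)))%N.
Proof.
set h := d./2 => cD cw.
have cDw : #|D :\: w| = h by have := cardsID w D; lia.
(* Degree budget: multiplying [h] free coefficients by [z], of degree [#|~: D|], gives a polynomial
   with at most [uphalf d] coefficients. *)
have cDC : (#|~: D| + h = uphalf d)%N.
  by have := cardsC D; rewrite card_ord uphalf_half /h; have := odd_double_half d; lia.
pose z : {poly K} := \prod_(a <- [seq pt j | j <- enum (~: D)]) ('X - a%:P).
have sz : size z = #|~: D|.+1 by rewrite /z big_map size_prod_XsubC -cardE.
have z_neq0 : z != 0 by rewrite -size_poly_eq0 sz.
pose lft (u : {poly_h K}) : {poly K} := z * val u.
have lft_inj : injective lft by move=> u v /(mulfI z_neq0) /val_inj.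
have lft_size u : (size (lft u) <= uphalf d)%N.
  have su : (size (val u) <= h)%N := size_npoly u.
  by apply: leq_trans (size_polyMleq _ _) _; rewrite sz; lia.
have lft_off u j : j \notin D -> values (lft u) j = psi 0.
  move=> jD; rewrite ffunE hornerM; have -> : z.[pt j] = 0; last by rewrite mul0r.
  by apply/eqP; rewrite -/(root _ _) root_prod_XsubC map_f // mem_enum inE.
have card_off (E : {set 'I_d}) : E \subset D -> #|E| = h -> #|E :|: ~: D| = uphalf d.
  move=> ED cE; rewrite cardsU (_ : E :&: ~: D = set0) ?cards0; first by lia.
  by apply/eqP; rewrite setI_eq0 disjoints_subset setCK.
set M := coef_mx _ _ _ _ _.
pose idx (k : 'I_#|{poly_h K}|) := enum_rank (values (lft (enum_val k))).
(* The rows and columns indexed by the polynomials [lft u] form an identity matrix of size |K|^h. *)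
suff E : rowsub idx 1%:M *m M *m colsub idx 1%:M = 1%:M.
  by rewrite -card_npoly; apply: mulmx1_min_rank E.
rewrite mul_rowsub_mx mul1mx mulmx_colsub mulmx1; apply/matrixP => k l.
rewrite !mxE /idx !enum_rankK mcoeff_NW.
have -> : (k == l) = (enum_val k == enum_val l) by rewrite (inj_eq enum_val_inj).
move: (enum_val k) (enum_val l) => u v {k l}.
set g := mix _ _ _ _ _.
(* On each half of [D] together with the complement of [D], [f] is prescribed at [uphalf d] points,
   hence determined. *)
have only (f : {poly_(uphalf d) K}) : values (val f) = g -> val f = lft u /\ val f = lft v.
  move=> e; have sf : (size (val f) <= uphalf d)%N := size_npoly f.
  split.
    apply: (@interpolation_uniq ((D :&: w) :|: ~: D));
      rewrite ?card_off ?subsetIl // => j; rewrite e !inE => jE.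
    rewrite ffunE; case: ifP jE => [jD /=|/negbT jD _]; last by rewrite lft_off.
    by rewrite orbF => ->.
  apply: (@interpolation_uniq ((D :\: w) :|: ~: D));
    rewrite ?card_off ?subsetDl // => j; rewrite e !inE => jE.
  rewrite ffunE; case: ifP jE => [jD /=|/negbT jD _]; last by rewrite lft_off.
  by rewrite andbT orbF => /negPf ->.
have [uv|uv] := eqVneq u v; last first.
  rewrite big1 // => f _; case: eqP => // /only[e1 e2].
  by rewrite e1 in e2; move/lft_inj: e2 uv => ->; rewrite eqxx.
have lftP : lft u \is a poly_of_size (uphalf d) by apply: lft_size.
rewrite (bigD1 (NPoly lftP)) //= big1 ?addr0.
  suff -> : values (lft u) = g by rewrite eqxx.
  apply/ffunP => j; rewrite [RHS]ffunE -uv; case: ifP => [_|/negbT /lft_off //].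
  by case: ifP.
move=> f ne; case: eqP => // /only[e _]; case/eqP: ne; exact: val_inj.
Qed.

End NisanWigderson.

(** * The lower bound *)

(** The left side counts the [w] inside [D] of size d./2; each has relative rank at least 1, and
    [bounded_formula] bounds the sum over all [w]. *)
Lemma NW_formula_size (R : realType) (n d : nat) (K : finFieldType) (phi : 'I_n -> K)
    (psi : K -> 'I_n) (F : fieldType) (hdn : (d <= n)%N) (G : formula n d F) :
  (4 <= n)%N -> #|K| = n -> cancel phi psi -> cancel psi phi ->
  set_multilinear_formula G -> feval G = NW hdn phi psi F ->
  'C((d./2).*2, d./2)%:R <= 2 ^+ d * ((fsize G)%:R * potential R (d./2).*2).
Proof.
move=> n_ge4 cK phiK psiK smG evG; set h := d./2.
have [D /eqP cD] : exists D : {set 'I_d}, #|D| == h.*2.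
  have : (0 < #|[set A : {set 'I_d} | A \subset setT & #|A| == h.*2]|)%N.
    by rewrite cards_draws cardsT card_ord bin_gt0 /h; lia.
  by case/card_gt0P => D; rewrite inE subsetT; exists D.
have := @bounded_formula R n d F D (psi 0) n_ge4 (potential R) (fun m => expR_ge0 _)
  (@potential_small R) (@potential_merge R) G smG setT.
rewrite setTI cD evG; apply: le_trans.
rewrite -cD -cards_draws -sumr_const.
rewrite [leRHS](bigID (mem [set A : {set 'I_d} | A \subset D & #|A| == h])) /= -[leLHS]addr0.
apply: lerD; last by apply: sumr_ge0 => w _; apply: relrank_ge0.
apply: ler_sum => w; rewrite inE => /andP[wD /eqP cw].
have sqrt_gt0 : 0 < Num.sqrt n%:R :> R by rewrite sqrtr_gt0 ltr0n; lia.
rewrite /relrank ler_pdivlMr ?exprn_gt0 //.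
rewrite mul1r setTI cD -mul2n exprM sqr_sqrtr ?ler0n // -natrX ler_nat -{1}cK.
by apply: rank_coef_mx_NW => //; rewrite (setIidPr wD).
Qed.

(** Here [t] is an upper bound for log d. The factor exp(t + 1) is the polynomial loss, absorbed by
    halving the leading coefficient 1/128. *)
Lemma quasipoly_le (R : realType) (d : nat) (t s : R) :
  (1 <= d)%N -> ln d%:R <= t * ln 2 -> 259 <= t ->
  expR ((t - 1) * t / 128) <= expR (t + 1) * s ->
  d%:R `^ (1 / 256 * (ln d%:R / ln 2)) <= s.
Proof.
move=> d_gt0 le_ln t_ge le_s.
have ln2_gt0 : 0 < ln (2 : R) by rewrite ln_gt0 // ltr1n.
have ln2_le : ln (2 : R) <= 1.
  rewrite -[leRHS](expRK 1) ler_ln ?posrE ?expR_gt0 //.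
  by apply: le_trans (expR_ge1Dx 1); lra.
have lnd_ge0 : 0 <= ln (d%:R : R) by rewrite ln_ge0 // ler1n.
apply: (@le_trans _ _ (expR ((t - 1) * t / 128 - (t + 1)))); last first.
  by rewrite expRD expRN ler_pdivrMr ?expR_gt0 // [s * _]mulrC.
rewrite /powR pnatr_eq0 (gtn_eqF d_gt0) ler_expR.
(* This amounts to t^2 - 258 t - 256 >= 0, which holds from 259 on. *)
apply: (@le_trans _ _ (t ^+ 2 / 256)); last by nra.
rewrite mulrA mulrAC ler_pdivrMr //.
have := ler_pM lnd_ge0 lnd_ge0 le_ln le_ln; nra.
Qed.

Theorem theorem3p5 (R : realType) :
  exists c : R, 0 < c /\
  exists d0 : nat,
  forall (k n d : nat) (K : finFieldType) (phi : 'I_n -> K) (psi : K -> 'I_n)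
    (F : fieldType) (hdn : (d <= n)%N) (G : formula n d F),
    (1 <= k)%N -> n = (2 ^ k)%N -> #|K| = n ->
    cancel phi psi -> cancel psi phi ->
    (d0 <= d)%N ->
    set_multilinear_formula G ->
    feval G = NW hdn phi psi F ->
    d%:R `^ (c * (ln d%:R / ln 2)) <= (fsize G)%:R :> R.
Proof.
exists (1 / 256); split; first by lra.
(* [N] stays abstract so that 2^N is never evaluated; 258 makes T + 1 reach the threshold 259. *)
have [N N_ge] : exists N, (258 <= N)%N by exists 258%N.
(* The successor keeps 2 (d./2) >= 2^N when d is odd. *)
exists (2 ^ N).+1 => k n d K phi psi F hdn G _ _ cK phiK psiK d_ge smG evG.
have pN_ge : (4 <= 2 ^ N)%N by rewrite (@leq_exp2l 2 2) //; lia.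
have n_ge4 : (4 <= n)%N by lia.
have := NW_formula_size R n_ge4 cK phiK psiK smG evG.
set h := d./2; set s := fsize G => bnd.
have h2_gt0 : (0 < h.*2)%N by rewrite /h; lia.
pose T := trunc_log 2 h.*2.
have T_ge : (N <= T)%N by apply: trunc_log_max => //; rewrite /h; lia.
have h2_lt : (h.*2 < 2 ^ T.+1)%N by apply: trunc_log_ltn.
have d_le : (d <= 2 ^ T.+1)%N by move: h2_lt; rewrite /h; lia.
apply: (@quasipoly_le R d T.+1%:R).
- by lia.
- rewrite mulr_natl -lnXn ?ltr0n // ler_ln ?posrE ?exprn_gt0 ?ltr0n //; last by lia.
  by rewrite -natrX ler_nat.
- by rewrite ler_nat; lia.
have decayT := decay_ge R h2_gt0; rewrite -/T in decayT.
rewrite -natr1 addrK natr1.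
apply: le_trans (_ : expR (decay R h.*2) <= _); first by rewrite ler_expR.
(* The factor 2 is the cost of the block dropped when d is odd. *)
have E : (2 ^+ d : R) <= 2 * 4 ^+ h.
  rewrite (_ : 2 * 4 ^+ h = 2 ^+ (h.*2).+1); first by rewrite ler_weXn2l ?ler1n // /h; lia.
  by rewrite exprS -mul2n exprM -!natrX.
have C : (4 ^+ h : R) <= h.*2.+1%:R * 'C(h.*2, h)%:R.
  by rewrite -natrX -natrM ler_nat central_bin_ge.
(* The total polynomial loss, from parity and from the central binomial, is at most 2^(T + 2), hence
   at most exp(T + 2). *)
have P2 : (2 : R) * h.*2.+1%:R <= expR (T.+1%:R + 1).
  apply: (@le_trans _ _ (2 ^+ T.+2)); first by rewrite -natrM -natrX ler_nat expnS leq_mul2l.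
  rewrite natr1 -[T.+2%:R]mulr1 expRM_natl lerXn2r ?nnegrE ?expR_ge0 //.
  by apply: le_trans (expR_ge1Dx 1); lra.
have p_gt0 : 0 < (4 ^+ h : R) by rewrite exprn_gt0.
have pot : potential R h.*2 * expR (decay R h.*2) = 1.
  by rewrite /potential expRN mulVf ?gt_eqF ?expR_gt0.
rewrite -(ler_pM2l p_gt0).
have step : (4 ^+ h : R) <= h.*2.+1%:R * (2 * 4 ^+ h * (s%:R * potential R h.*2)).
  apply: le_trans C _; rewrite ler_wpM2l ?ler0n //; apply: le_trans bnd _.
  by rewrite ler_wpM2r // mulr_ge0 ?ler0n ?expR_ge0.
apply: le_trans (ler_wpM2r (expR_ge0 _) step) _.
rewrite (_ : _ * expR _ = 4 ^+ h * (2 * h.*2.+1%:R * s%:R) *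
  (potential R h.*2 * expR (decay R h.*2))); last by ring.
by rewrite pot mulr1 ler_pM2l // ler_wpM2r ?ler0n.
Qed.
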